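(* Let $H_3$ have simple generators $s,t,u$ with $m_{st}=5$, $m_{tu}=3$, $m_{su}=2$, and let $\omega$ be its Coxeter sign character. The parabolic pairs $(H_3,\langle s,t\rangle)$ and $(H_3,\langle t,u\rangle)$ are Gelfand pairs of ranks four and six, respectively, and $(H_3,\ker\omega)$ is a rank-two Gelfand pair. The triple $(H_3,\langle s,u\rangle,\alpha)$ with $\alpha(s)=1$, $\alpha(u)=-1$ is a linear Gelfand triple of rank eight, whereas the ordinary pair $(H_3,\langle s,u\rangle)$ is not a Gelfand pair.
   Context: $\omega(w)=(-1)^{\ell(w)}$. For finite groups $H\le G$ and a linear complex character $\lambda$ of $H$, $(G,H,\lambda)$ is a linear Gelfand triple if $\mathrm{Ind}_H^G\lambda$ is multiplicity-free; if $\lambda=\mathbf 1$ one says $(G,H)$ is a Gelfand pair. The rank is the dimension of $\mathscr A(G,H,\lambda)=e_\lambda\mathbb CGe_\lambda$, $e_\lambda=|H|^{-1}\sum_{h\in H}\lambda(h^{-1})h$. *)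

(* Defs.v *)
From HB Require Import structures.
From mathcomp Require Import all_boot all_order all_algebra.
From mathcomp Require Import all_fingroup all_solvable all_field all_character.

Set Implicit Arguments.
Unset Strict Implicit.
Unset Printing Implicit Defensive.

Import Order.TTheory GRing.Theory Num.Theory GroupScope.
Local Open Scope ring_scope.

Definition H3_relations (rT : groupType) (x y z : rT) : Prop :=
  [/\ x ^+ 2 = 1, y ^+ 2 = 1 & z ^+ 2 = 1]%g /\
  [/\ (x * y) ^+ 5 = 1, (y * z) ^+ 3 = 1 & (x * z) ^+ 2 = 1]%g.

(* The group is the whole finite type gT. The last clause is the universal
   property of the Coxeter presentation, tested against all groups, infinite
   ones included; it also forces s, t, u to be distinct and the orders of the
   products s * t, t * u, s * u to be exactly 5, 3, 2. *)
Definition H3_coxeter_system (gT : finGroupType) (s t u : gT) : Prop :=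
  [/\ <<[set s; t; u]>>%g = [set: gT],
      H3_relations s t u
    & forall (rT : groupType) (x y z : rT), H3_relations x y z ->
      exists f : gT -> rT,
        {morph f : a b / (a * b)%g} /\ [/\ f s = x, f t = y & f u = z]].

(* (S ^+ n)%g is the set of products of n elements of S. When S consists of
   involutions generating gT, the partial products of a shortest word for w
   are distinct, so the search below #|gT| always succeeds. *)
Definition coxeter_length (gT : finGroupType) (S : {set gT}) (w : gT) : nat :=
  find (fun n => w \in (S ^+ n)%g) (iota 0 #|gT|).

Definition multiplicity_free (gT : finGroupType) (G : {group gT})
    (phi : 'CF(G)) : Prop :=
  forall i : Iirr G, '[phi, 'chi_i] <= 1.

Definition linear_gelfand_triple (gT : finGroupType) (G H : {group gT})
    (lambda : 'CF(H)) : Prop :=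
  [/\ H \subset G, lambda \is a linear_char
    & multiplicity_free ('Ind[G] lambda)].

Definition gelfand_pair (gT : finGroupType) (G H : {group gT}) : Prop :=
  linear_gelfand_triple G (1 : 'CF(H)).

(* The group algebra of G is represented faithfully by its regular matrices
   (group_ring), so that e_lambda is a matrix. *)
Definition hecke_idempotent (gT : finGroupType) (G H : {group gT})
    (lambda : 'CF(H)) : 'M[algC]_#|G| :=
  (#|H|%:R)^-1 *: \sum_(h in H) lambda (h^-1)%g *: regular_repr algC G h.

(* The product (_ * _ * _)%MS is the linear span of the matrices
   e_lambda *m a *m e_lambda, with a in the group algebra. *)
Definition hecke_algebra (gT : finGroupType) (G H : {group gT})
    (lambda : 'CF(H)) : 'A[algC]_#|G| :=
  let e := mxvec (hecke_idempotent G lambda) in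
  (e * group_ring algC G * e)%MS.

Definition gelfand_rank (gT : finGroupType) (G H : {group gT})
    (lambda : 'CF(H)) : nat :=
  \rank (hecke_algebra G lambda).

(* Main.v *)
(* Let lambda be a linear character of H <= G and e its idempotent.
   The sandwich A |-> e A e is a projection of the group algebra, and its trace
   is the squared norm of Ind lambda, which is a count in G. If inversion fixes
   the Hecke algebra then the latter is commutative, and an idempotent E of a
   full matrix algebra M with E M E commutative has trace 0 or 1, so Ind lambda
   is multiplicity-free. If phi is multiplicity-free then '[phi, psi] <= '[psi]
   for every character psi; this is violated by the permutation characters of
   H3 on the edges (phi) and the vertices (psi) of the icosahedron, for which
   the two sides are 5 and 4.
   The counts are evaluated in permutations of the 12 vertices. The universal
   property maps the abstract group there, and a complete rewriting system for
   H3 shows that it has at most 120 elements, so that the map is injective. *)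

Require Import Defs.
From HB Require Import structures.
From mathcomp Require Import all_boot all_order all_algebra.
From mathcomp Require Import all_fingroup all_solvable all_field all_character.

Set Implicit Arguments.
Unset Strict Implicit.
Unset Printing Implicit Defensive.

Import Order.TTheory GRing.Theory Num.Theory GroupScope.
Local Open Scope ring_scope.

(** * Traces of idempotent matrices *)

(** In a full-rank factorization [E = C R], idempotence forces [R C = 1], and
    [\tr (C R) = \tr (R C)]. *)
Lemma mxtrace_idempotent (F : fieldType) n (E : 'M[F]_n) :
  E *m E = E -> \tr E = (\rank E)%:R.
Proof.
move=> idE; rewrite -{1}(mulmx_base E) mxtrace_mulC.
suff ->: row_base E *m col_base E = 1%:M by rewrite mxtrace1.
apply: (row_full_inj (col_base_full E)); apply: (row_free_inj (row_base_free
  E)).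
by rewrite mulmx1 mulmxA mulmx_base -mulmxA mulmx_base.
Qed.

Lemma mul_delta_mxE (F : fieldType) m n p q (A : 'M[F]_(m, n)) (B : 'M_(p, q))
    i j k l :
  (A *m delta_mx k l *m B) i j = A i k * B l j.
Proof.
rewrite -(mul_delta_mx (0 : 'I_1)) mulmxA -mulmxA -colE -rowE mxE big_ord1.
by rewrite !mxE.
Qed.

(** Commutativity is tested on the matrix units [(a, i)] and [(j, a)], where [E i j] is nonzero. At
    entry [(i, j)] it reads [E i j * E i a * E a j = E i j ^+ 2 * E a a]; summing over [a] turns the
    left side into [E i j ^+ 2] and the right side into [E i j ^+ 2 * \tr E]. *)
Lemma mxtrace_idempotent_comm (F : fieldType) n (E : 'M[F]_n) :
    E *m E = E ->
    (forall A B : 'M_n, E *m A *m E *m B *m E = E *m B *m E *m A *m E) ->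
  \tr E = 0 \/ \tr E = 1.
Proof.
move=> idE commE.
have [->|nzE] := eqVneq E 0; first by left; rewrite mxtrace0.
have [i [j nzEij]]: exists i, exists j, E i j != 0.
  case: (pickP (fun ij : 'I_n * 'I_n => E ij.1 ij.2 != 0)) => [[i j]|E0].
    by exists i, j.
  case/eqP: nzE; apply/matrixP=> i j; rewrite mxE; apply/eqP.
  by move/negbFE: (E0 (i, j)).
right; apply: (mulfI nzEij); apply: (mulfI nzEij); rewrite mulr1.
transitivity (E i j * (E *m E) i j); last by rewrite idE.
rewrite mxE !mulr_sumr; apply: eq_bigr => a _.
have /matrixP/(_ i)/(_ j) := commE (delta_mx a i) (delta_mx j a).
rewrite !mul_delta_mxE => eq_ij.
by rewrite mulrA mulrAC -eq_ij mulrAC mulrC.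
Qed.

(** * Idempotents of linear characters and Gelfand's trick *)

(** Frobenius reciprocity: a multiplicity in the induced character is the trace of the idempotent of
    [lambda] in the irreducible representation. Complex conjugation becomes inversion, whence the
    reindexing. *)
Lemma cfdot_Ind_irr_trace (gT : finGroupType) (G H : {group gT})
    (lambda : 'CF(H)) (i : Iirr G) :
  H \subset G -> lambda \is a linear_char ->
  '['Ind[G] lambda, 'chi_i] =
  \tr (#|H|%:R^-1 *: \sum_(h in H) lambda (h^-1)%g *: 'Chi_i h).
Proof.
move=> sHG Llam; rewrite -Frobenius_reciprocity cfdotE mxtraceZ raddf_sum /=.
congr (_ * _); rewrite (reindex_inj invg_inj) /=; apply: eq_big => [h|h];
  rewrite groupV // => Hh.
rewrite mxtraceZ cfResE ?groupV //; congr (_ * _).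
by rewrite -char_inv ?irr_char // invgK -irrRepr cfunE (subsetP sHG).
Qed.

Section LinearIdempotent.

Variables (gT : finGroupType) (G H : {group gT}) (lambda : 'CF(H)).
Variables (n : nat) (rG : mx_representation algC G n).

(** The image of the idempotent in an arbitrary representation. The regular one gives
    [hecke_idempotent], the irreducible ones give multiplicities. *)
Definition linear_idempotent : 'M[algC]_n :=
  #|H|%:R^-1 *: \sum_(h in H) lambda h^-1%g *: rG h.

Hypotheses (sHG : H \subset G) (Llam : lambda \is a linear_char).

Let lamVK h : h \in H -> lambda h * lambda h^-1%g = 1.
Proof. by move=> Hh; rewrite lin_charV // mulfV ?lin_char_neq0. Qed.

Lemma linear_idempotent_mulr h :
  h \in H -> linear_idempotent *m rG h = lambda h *: linear_idempotent.
Proof.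
move=> Hh; rewrite /linear_idempotent -scalemxAl scalerA mulrC -scalerA.
congr (_ *: _); rewrite mulmx_suml scaler_sumr.
rewrite [RHS](reindex_acts 'R _ Hh) ?astabsR //=.
apply: eq_bigr => k Hk; rewrite -scalemxAl repr_mxM ?(subsetP sHG) //.
by rewrite scalerA invMg lin_charM ?groupV // mulrA lamVK ?mul1r.
Qed.

Lemma linear_idempotent_mull h :
  h \in H -> rG h *m linear_idempotent = lambda h *: linear_idempotent.
Proof.
move=> Hh; rewrite /linear_idempotent -scalemxAr scalerA mulrC -scalerA.
congr (_ *: _); rewrite mulmx_sumr scaler_sumr.
rewrite [RHS](reindex_inj (mulgI h)) /=.
apply: eq_big => [k|k Hk]; first by rewrite groupMl.
rewrite -scalemxAr repr_mxM ?(subsetP sHG) //.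
by rewrite scalerA invMg lin_charM ?groupV // mulrCA lamVK ?mulr1.
Qed.

Lemma linear_idempotentK :
  linear_idempotent *m linear_idempotent = linear_idempotent.
Proof.
rewrite {2}/linear_idempotent -scalemxAr mulmx_sumr.
rewrite (eq_bigr (fun=> linear_idempotent)) => [|h Hh]; last first.
  by rewrite -scalemxAr linear_idempotent_mulr // scalerA mulrC lamVK ?scale1r.
by rewrite sumr_const -scaler_nat scalerA mulVf ?scale1r ?neq0CG.
Qed.

Lemma linear_idempotent_sandwich x :
    x \in G ->
  linear_idempotent *m rG x *m linear_idempotent =
    \sum_(h in H) \sum_(k in H)
      (lambda h^-1%g * lambda k^-1%g / #|H|%:R ^+ 2) *: rG (h * x * k)%g.
Proof.
move=> Gx; rewrite /linear_idempotent -!scalemxAl -!scalemxAr scalerA.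
rewrite !mulmx_suml scaler_sumr; apply: eq_bigr => h Hh.
rewrite mulmx_sumr scaler_sumr; apply: eq_bigr => k Hk.
rewrite -!scalemxAl -scalemxAr !scalerA !repr_mxM ?groupM ?(subsetP sHG h)
  ?(subsetP sHG k) //.
by rewrite -invfM -expr2 mulrC.
Qed.

End LinearIdempotent.

(* Gelfand's trick, with the inversion as anti-involution: the hypothesis says
   that e x e = e x^-1 e in the Hecke algebra, both sides being 0 in the second
   case, so that inversion fixes the Hecke algebra and makes it commutative. *)
Definition inversion_invariant (gT : finGroupType) (G H : {group gT})
    (lambda : 'CF(H)) : Prop :=
  {in H, forall h, lambda h^-1%g = lambda h} /\
  forall x, x \in G -> exists h k, [/\ h \in H, k \in H &
    (h * x * k = x^-1)%g /\ lambda h * lambda k = 1 \/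
    (h * x * k = x)%g /\ lambda h * lambda k != 1].

(** Sandwiches [E A E] commute when [A] runs over the representing matrices, hence over their span.
    This span is the full matrix algebra, so that [mxtrace_idempotent_comm] applies. *)
Lemma linear_idempotent_trace (gT : finGroupType) (G H : {group gT})
    (lambda : 'CF(H)) n (rG : mx_representation algC G n) :
    H \subset G -> lambda \is a linear_char -> inversion_invariant G lambda ->
    row_full (enveloping_algebra_mx rG) ->
  let t := \tr (linear_idempotent lambda rG) in t = 0 \/ t = 1.
Proof.
move=> sHG Llam [lamV symG] fullG /=.
have [E defE] : {E | E = linear_idempotent lambda rG} by exists
  (linear_idempotent lambda rG).
rewrite -defE.
have sHGm h : h \in H -> h \in G by apply: (subsetP sHG).
have idE : E *m E = E by rewrite defE; apply: linear_idempotentK.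
have El h : h \in H -> rG h *m E = lambda h *: E by rewrite defE;
  apply: linear_idempotent_mull.
have Er h : h \in H -> E *m rG h = lambda h *: E by rewrite defE;
  apply: linear_idempotent_mulr.
have bimod h k x : h \in H -> k \in H -> x \in G ->
  E *m rG (h * x * k)%g *m E = (lambda h * lambda k) *: (E *m rG x *m E).
  move=> Hh Hk Gx; rewrite !repr_mxM ?groupM ?(sHGm h) ?(sHGm k) // !mulmxA (Er
    h) //.
  by rewrite -!mulmxA (El k) // -scalemxAl -!scalemxAr scalerA.
have EV x : x \in G -> E *m rG x^-1%g *m E = E *m rG x *m E.
  move=> Gx; have [h [k [Hh Hk [[<- e1]|[defx ne1]]]]] := symG x Gx.
    by rewrite bimod // e1 scale1r.
  (* A sandwich equal to a scalar multiple of itself, with scalar other than 1, is zero. This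
     applies to [x], and to [x^-1] after inverting [h * x * k = x]. *)
  have zero y a : E *m rG y *m E = a *: (E *m rG y *m E) -> a != 1 ->
      E *m rG y *m E = 0.
    move=> /eqP; rewrite -{1}[_ *m E]scale1r -subr_eq0 -scalerBl scaler_eq0.
    by rewrite subr_eq0 eq_sym => /orP[-> //|/eqP].
  rewrite (zero x (lambda h * lambda k)) -?bimod ?defx //.
  apply: (zero _ (lambda k * lambda h)); last by rewrite mulrC.
  rewrite -(lamV h) // -(lamV k) // -bimod ?groupV //.
  by rewrite -!invMg mulgA defx.
have commG x y : x \in G -> y \in G ->
  E *m rG x *m E *m rG y *m E = E *m rG y *m E *m rG x *m E.
  (* Expanding the middle [E] gives an average of sandwiches of [a * h * b]. Inverting these
     elements and replacing [h] by its inverse yields the product for [y^-1] and [x^-1], which [EV]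
     turns into that for [y] and [x]. *)
  have expand a b : a \in G -> b \in G -> E *m rG a *m E *m rG b *m E =
    #|H|%:R^-1 *: \sum_(h in H) lambda h^-1%g *: (E *m rG (a * h * b)%g *m E).
    move=> Ga Gb; rewrite {2}defE -scalemxAr -!scalemxAl.
    congr (_ *: _); rewrite mulmx_sumr !mulmx_suml; apply: eq_bigr => h Hh.
    by rewrite -scalemxAr -!scalemxAl !repr_mxM ?groupM ?(sHGm h) // !mulmxA.
  move=> Gx Gy; rewrite expand //.
  rewrite (reindex_inj invg_inj) /=.
  under eq_big => [h|h]; first by rewrite groupV; over.
    rewrite groupV => Hh; rewrite -EV ?groupM ?groupV ?(sHGm h) //.
    rewrite !invMg !invgK mulgA -lamV //; over.
  rewrite -(expand (y^-1) (x^-1))%g ?groupV // EV //.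
  by rewrite -!mulmxA [X in _ *m (_ *m X)]mulmxA EV // !mulmxA.
apply: mxtrace_idempotent_comm => // A B.
have /envelop_mxP[a ->] : (A \in enveloping_algebra_mx rG)%MS by apply:
  submx_full.
have /envelop_mxP[b ->] : (B \in enveloping_algebra_mx rG)%MS by apply:
  submx_full.
rewrite !(mulmx_sumr, mulmx_suml); under eq_bigr do rewrite !(mulmx_sumr,
  mulmx_suml).
rewrite exchange_big /=; apply: eq_bigr => x Gx.
rewrite !(mulmx_sumr, mulmx_suml); apply: eq_bigr => y Gy.
do 4! rewrite -?scalemxAr -?scalemxAl.
by rewrite !scalerA mulrC commG.
Qed.

Lemma gelfand_trick (gT : finGroupType) (G H : {group gT}) (lambda : 'CF(H)) :
    H \subset G -> lambda \is a linear_char -> inversion_invariant G lambda ->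
  linear_gelfand_triple G lambda.
Proof.
move=> sHG Llam inv; split=> // i; rewrite cfdot_Ind_irr_trace //.
rewrite -[_ *: _]/(linear_idempotent lambda 'Chi_i).
(* Burnside's theorem: over an algebraically closed field an irreducible representation spans the
   full matrix algebra. *)
have: mx_absolutely_irreducible 'Chi_i.
  apply: groupC; apply: socle_irr.
case/andP=> _ /(linear_idempotent_trace sHG Llam inv)[] ->;
by rewrite ?ler01.
Qed.

(** * Intertwining numbers and the rank of the Hecke algebra *)

(** Mackey's intertwining number without double cosets: [psi] vanishes outside [K], so [x] may run
    over all of [G]. *)
Lemma cfdot_Ind (gT : finGroupType) (G H K : {group gT})
    (phi : 'CF(H)) (psi : 'CF(K)) :
  H \subset G -> K \subset G ->
  '['Ind[G] phi, 'Ind[G] psi] =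
  (#|H|%:R * #|K|%:R)^-1 *
    \sum_(h in H) \sum_(x in G) phi h * (psi (h ^ x)%g)^*.
Proof.
move=> sHG sKG; rewrite -Frobenius_reciprocity cfdotE invfM -mulrA.
congr (_ * _); rewrite mulr_sumr; apply: eq_bigr => h Hh;
  rewrite cfResE // cfIndE //.
by rewrite rmorphM /= fmorphV rmorph_nat rmorph_sum /= mulrCA mulr_sumr.
Qed.

(** The single row [mxvec e] spans a line, so the product of spaces is the image of [R] under the
    linear map taking [A] to [e A e]. *)
Lemma mulsmx_sandwich (F : fieldType) m n (R : 'A[F]_(m, n)) (e : 'M_n) :
  (mxvec e * R * mxvec e :=: R *m lin_mx (mulmxr e \o mulmx e))%MS.
Proof.
apply/eqmxP/andP; split; last first.
  apply/row_subP=> i; rewrite row_mul mul_rV_lin /= !mem_mulsmx ?submx_refl //.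
  by rewrite vec_mxK row_sub.
apply/mulsmx_subP => _ A2 /mulsmxP[A1 eA1 [B1 RB1 ->]] /sub_rVP[b].
rewrite -linearZ => /(can_inj mxvecK)->.
rewrite -scalemxAr mulmx_suml linearZ linear_sum scalemx_sub ?summx_sub // => i
  _.
have /sub_rVP[c] := eA1 i; rewrite -linearZ => /(can_inj mxvecK)->.
rewrite -!scalemxAl linearZ scalemx_sub //.
by have /= <- := mul_vec_lin (mulmxr e \o mulmx e) (B1 i); apply: submxMr.
Qed.

(** [Q] is the matrix of the projection [P] on the row space of [R], in the basis of the rows of
    [R]. It inherits idempotence, so its trace is its rank. *)
Lemma mxtrace_lin_mx (F : fieldType) m n (R : 'M[F]_(m, n)) (Q : 'M_m) (P :
  'M_n) :
  row_free R -> Q *m R = R *m P -> P *m P = P -> (\rank (R *m P))%:R = \tr Q.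
Proof.
move=> freeR QR PP; rewrite -QR mxrankMfree // mxtrace_idempotent //.
by apply: (row_free_inj freeR); rewrite -mulmxA QR mulmxA QR -mulmxA PP.
Qed.

(** The rank is the trace of the sandwich map in the basis [G] of the group algebra. The diagonal
    entry at [x] collects the pairs with [h * x * k = x], that is [k = (h ^ x)^-1], and this is the
    sum in [cfdot_Ind]. *)
Lemma gelfand_rank_cfnorm (gT : finGroupType) (G H : {group gT})
    (lambda : 'CF(H)) :
  H \subset G -> lambda \is a linear_char ->
  (gelfand_rank G lambda)%:R = '['Ind[G] lambda].
Proof.
move=> sHG Llam; rewrite /gelfand_rank /hecke_algebra /=.
rewrite -[hecke_idempotent _ _]/(linear_idempotent lambda (regular_repr algC
  G)).
have [e defe] : {e | e = linear_idempotent lambda (regular_repr algC G)}.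
  by exists (linear_idempotent lambda (regular_repr algC G)).
have idE : e *m e = e by rewrite defe linear_idempotentK.
rewrite -defe mulsmx_sandwich.
pose a (hk : gT * gT) := lambda hk.1^-1%g * lambda hk.2^-1%g / #|H|%:R ^+ 2.
pose Q : 'M[algC]_#|G| := \matrix_(i, j)
  \sum_(h in H) \sum_(k in H) a (h, k) * (h * enum_val i * k == enum_val
    j)%g%:R.
rewrite (@mxtrace_lin_mx _ _ _ _ Q) ?gring_free //; first last.
- apply/row_matrixP=> i; rewrite row_mul rowE !mul_rV_lin /= mxvecK.
  by rewrite !mulmxA idE -!mulmxA idE.
- apply/row_matrixP=> i; rewrite !row_mul rowK mul_vec_lin /=.
  have -> : row i Q = \sum_(h in H) \sum_(k in H) a (h, k) *:
      delta_mx 0 (gring_index G (h * enum_val i * k)%g).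
    apply/rowP=> j; rewrite !mxE summxE; apply: eq_bigr => h Hh.
    rewrite summxE; apply: eq_bigr => k Hk;
      rewrite !mxE eqxx /= -(inj_eq enum_val_inj).
    by rewrite gring_indexK ?groupM ?enum_valP ?(subsetP sHG h) ?(subsetP sHG
      k) 1?eq_sym.
  rewrite -[regular_mx _ _ _]/(regular_repr algC G (enum_val i)).
  rewrite defe linear_idempotent_sandwich ?enum_valP // mulmx_suml linear_sum.
  apply: eq_bigr => h Hh; rewrite mulmx_suml linear_sum; apply: eq_bigr => k Hk.
  rewrite -scalemxAl linearZ -rowE rowK gring_indexK //.
  by rewrite !groupM ?enum_valP ?(subsetP sHG h) ?(subsetP sHG k).
(* The reindexing matches the values [lambda h^-1] occurring in the idempotent. *)
rewrite cfdot_Ind // -expr2 mulr_sumr (reindex_inj invg_inj) /=.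
rewrite /mxtrace.
transitivity (\sum_(i < #|G|) \sum_(h in H) \sum_(k in H)
    a (h, k) * (h * enum_val i * k == enum_val i)%g%:R).
  by apply: eq_bigr => i _; rewrite mxE.
rewrite exchange_big /=; apply: eq_big => [h|h Hh]; first by rewrite groupV.
rewrite -(big_enum_val (fun x => \sum_(k in H) a (h, k) * (h * x * k ==
  x)%g%:R)).
rewrite mulr_sumr; apply: eq_bigr => x Gx.
have eqx k : (h * x * k == x)%g = (k == (h ^ x)^-1)%g.
  rewrite -[RHS](inj_eq (mulgI (h * x)%g)) -conjVg conjgE !mulgA.
  by rewrite mulgK mulgV mul1g.
rewrite conjVg -char_inv ?lin_charW // invgK.
have [Hx|notHx] := boolP (h ^ x \in H)%g.
  rewrite (bigD1 (h ^ x)^-1)%g ?groupV //= big1 => [|k /andP[_ /negPf nk]].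
    by rewrite eqx eqxx mulr1 addr0 /a /= invgK mulrC.
  by rewrite eqx nk mulr0.
rewrite (cfun0 _ notHx) !mulr0 big1 // => k Hk; rewrite eqx.
by case: eqP => [dk|_]; rewrite ?mulr0 //; case/negP: notHx;
  rewrite -groupV -dk.
Qed.

(** * Tests for multiplicity-freeness; construction of linear characters *)

(** A multiplicity of at least 2 contributes at least 4 to the norm. *)
Lemma multiplicity_free_cfnorm (gT : finGroupType) (G : {group gT}) (phi :
  'CF(G)) :
  phi \is a character -> '[phi] < 4 -> multiplicity_free phi.
Proof.
move=> Nphi lt4 i; have /natrP[m def_m] : '[phi, 'chi_i] \in Num.nat.
  by apply: Cnat_cfdot_char_irr.
rewrite def_m lern1 leqNgt; apply/negP=> m_gt1.
have: (m * m)%:R < 4 :> algC.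
  apply: le_lt_trans lt4; rewrite cfdot_sum_irr (bigD1 i) //= def_m.
  rewrite conj_Creal ?realn // -natrM lerDl sumr_ge0 // => j _.
  by rewrite -normCK exprn_ge0.
by rewrite ltr_nat ltnNge (leq_mul m_gt1 m_gt1).
Qed.

(** Termwise, [m * n <= n * n] for natural numbers with [m <= 1]. *)
Lemma cfdot_multiplicity_free (gT : finGroupType) (G : {group gT})
    (phi psi : 'CF(G)) :
    phi \is a character -> psi \is a character -> multiplicity_free phi ->
  '[phi, psi] <= '[psi].
Proof.
move=> Nphi Npsi phi1; rewrite !cfdot_sum_irr; apply: ler_sum => i _.
have /natrP[m def_m] : '[phi, 'chi_i] \in Num.nat by apply: Cnat_cfdot_char_irr.
have /natrP[n def_n] : '[psi, 'chi_i] \in Num.nat by apply: Cnat_cfdot_char_irr.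
have := phi1 i; rewrite def_m def_n conj_Creal ?realn // -!natrM lern1 ler_nat.
move=> le_m1; have [->|n_gt0] := posnP n; first by rewrite muln0.
by rewrite leq_mul2r (leq_trans le_m1) ?orbT.
Qed.

(** [chi] is the trace of a representation of degree one; its values outside [H] are arbitrary. *)
Lemma lin_char_of_morph (gT : finGroupType) (H : {group gT}) (chi : gT -> algC)
  :
    chi 1%g = 1 -> {in H &, {morph chi : x y / (x * y)%g >-> x * y}} ->
  exists2 phi : 'CF(H), phi \is a linear_char & {in H, phi =1 chi}.
Proof.
move=> chi1 chiM; pose r g : 'M[algC]_1 := (chi g)%:M.
have rP : mx_repr H r.
  by split=> [|x y Hx Hy]; rewrite /r ?chi1 // chiM // scalar_mxM.
exists (cfRepr (MxRepresentation rP)).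
  by rewrite qualifE /= cfRepr_char cfRepr1 eqxx.
by move=> x Hx; rewrite cfunE Hx mxtrace_scalar.
Qed.

(** * Words, rewriting and computation with permutations as lists *)

Definition word := seq nat.

Fixpoint rewrite_step (R : seq (word * word)) (w : word) : word :=
  if w is a :: w' then
    if [seq r <- R | prefix r.1 w] is r :: _ then r.2 ++ drop (size r.1) w
    else a :: rewrite_step R w'
  else [::].

(** [n] is fuel: the value of the word is preserved even if reduction stops before a normal form. *)
Fixpoint reduce n (R : seq (word * word)) (w : word) : word :=
  if n is n'.+1 then
    let w' := rewrite_step R w in if w' == w then w else reduce n' R w'
  else w.

(* The letters 0, 1, 2 stand for s, t, u. *)
Definition coxeter_rules : seq (word * word) :=
  [:: ([:: 0; 0], [::]); ([:: 1; 1], [::]); ([:: 2; 2], [::]);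
      ([:: 2; 0], [:: 0; 2]); ([:: 2; 1; 2], [:: 1; 2; 1]);
      ([:: 1; 0; 1; 0; 1], [:: 0; 1; 0; 1; 0])]%N.

(* The Knuth-Bendix completion of coxeter_rules for the shortlex order. *)
Definition H3_rules : seq (word * word) :=
  coxeter_rules ++
  [:: ([:: 2; 1; 0; 2], [:: 1; 2; 1; 0]);
      ([:: 2; 1; 0; 1; 2; 1], [:: 1; 2; 1; 0; 1; 2]);
      ([:: 2; 1; 0; 1; 0; 2; 1; 0; 1; 0], [:: 1; 2; 1; 0; 1; 0; 2; 1; 0; 1])]%N.

(* Locked because unification would otherwise enumerate the group. *)
HB.lock Definition normal_words : seq word :=
  flatten (traject (fun ws => [seq w <- [seq rcons w a | w <- ws, a <- iota 0 3]
                              | rewrite_step H3_rules w == w]) [:: [::]] 16).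

(* The action of s, t, u on the 12 right cosets of <s, t>. *)
Definition point_perm (a : nat) : seq nat :=
  nth [::] [:: [:: 0; 1; 3; 2; 5; 4; 7; 6; 9; 8; 10; 11];
               [:: 0; 2; 1; 4; 3; 5; 6; 8; 7; 10; 9; 11];
               [:: 1; 0; 2; 3; 6; 7; 4; 5; 8; 9; 11; 10]]%N a.

(** Composition from left to right, in agreement with [permM]. *)
Definition pmul (p q : seq nat) : seq nat := [seq nth 0%N q i | i <- p].
Definition pinv (p : seq nat) : seq nat := [seq index i p | i <- iota 0 12].
Definition pword (w : word) : seq nat :=
  foldr (fun a => pmul (point_perm a)) (iota 0 12) w.

Definition H3_perms : seq (seq nat) := [seq pword w | w <- normal_words].
Definition parabolic_perms (A : seq nat) : seq (seq nat) :=
  [seq pword w | w <- normal_words & all (mem A) w].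

Definition pconj (p q : seq nat) : seq nat := pmul (pinv q) (pmul p q).

(** A function with values 1 and -1 on the subgroup listed by [l], negative exactly on [neg], and 0
    outside, as for class functions. Integer values keep the counts computable. *)
Definition pm_sign (neg l : seq (seq nat)) (p : seq nat) : int :=
  if p \in l then (-1) ^+ (p \in neg) else 0.

(* The group and its subgroups are arguments, so that call by value computes
   each of them only once. *)
Definition intertwining_count (W l neg m neg' : seq (seq nat)) : int :=
  foldr +%R 0 [seq foldr +%R 0
    [seq pm_sign neg l p * pm_sign neg' m (pconj p q) | q <- W] | p <- l].

Definition inversion_check (W l neg : seq (seq nat)) : bool :=
  let F := pm_sign neg l in
  all (fun h => F (pinv h) == F h) l &&
  all (fun p => has (fun h => has (fun k =>
      let q := pmul (pmul h p) k in let c := F h * F k in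
      (q == pinv p) && (c == 1) || (q == p) && (c != 1)) l) l) W.

(** The elements [u] and [s * u], where [alpha] is -1. *)
Definition su_neg : seq (seq nat) := [:: pword [:: 2]; pword [:: 0; 2]]%N.

Section Word.

Variables (gT : finGroupType) (gen : nat -> gT).

Definition ev (w : word) : gT := foldr (fun a => mulg (gen a)) 1%g w.

Lemma ev_cat v w : ev (v ++ w) = (ev v * ev w)%g.
Proof. by elim: v => [|a v IHv] /=; rewrite ?mul1g // IHv mulgA. Qed.

Lemma ev_rcons w a : ev (rcons w a) = (ev w * gen a)%g.
Proof. by rewrite -cats1 ev_cat /= mulg1. Qed.

Definition sound (R : seq (word * word)) : Prop :=
  {in R, forall r, ev r.1 = ev r.2}.

Lemma ev_rewrite_step R w : sound R -> ev (rewrite_step R w) = ev w.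
Proof.
move=> sR; elim: w => [//|a w IHw].
rewrite [rewrite_step _ _]/=; case def_r: [seq r <- R | _] => [|r R'].
  by rewrite /= IHw.
have: r \in [seq r <- R | prefix r.1 (a :: w)] by rewrite def_r mem_head.
rewrite mem_filter => /andP[/prefixP[v ->] /sR r12].
by rewrite drop_size_cat // !ev_cat r12.
Qed.

Lemma ev_reduce n R w : sound R -> ev (reduce n R w) = ev w.
Proof.
move=> sR; elim: n w => //= n IHn w.
by case: eqP => // _; rewrite IHn ev_rewrite_step.
Qed.

(* A Knuth-Bendix step: v and v' are two reducts of the overlap w. *)
Lemma sound_overlap R R1 n w v v' :
    sound R -> all (mem R) R1 -> reduce n R1 w = v -> reduce n R w = v' ->
  sound (rcons R (v, v')).
Proof.
move=> sR /allP sub1 <- <- r; rewrite mem_rcons inE => /predU1P[-> /=|/sR//].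
by rewrite !ev_reduce // => r' /sub1/sR.
Qed.

Lemma ev_rev w : (forall a, a \in w -> gen a ^+ 2 = 1)%g -> ev (rev w) = (ev
  w)^-1%g.
Proof.
elim: w => [|a w IHw] inv /=; first by rewrite invg1.
rewrite rev_cons ev_rcons invMg IHw => [|b wb]; last first.
  by apply: inv; rewrite inE wb orbT.
by congr (_ * _)%g; apply/esym/eqP; rewrite eq_invg_mul -expg2 inv ?mem_head.
Qed.

End Word.

(** * Permutations of 12 points coded by lists *)

Lemma uniq_map_inj (T T' : eqType) (f : T -> T') (l : seq T) :
  uniq (map f l) -> {in l &, injective f}.
Proof.
elim: l => [|a l IHl] //= /andP[notfa /IHl inj_l] x y; rewrite !inE.
case/predU1P=> [->|lx] /predU1P[->|ly] // eq_f; last exact: inj_l.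
  by rewrite eq_f map_f in notfa.
by rewrite -eq_f map_f in notfa.
Qed.

Section PermCode.

Definition perm_code (p : {perm 'I_12}) : seq nat :=
  mkseq (fun k => p (inord k) : nat) 12.

Lemma nth_perm_code p (i : 'I_12) : nth 0%N (perm_code p) i = p i.
Proof. by rewrite nth_mkseq // inord_val. Qed.

Lemma perm_code_inj : injective perm_code.
Proof.
move=> p q pq; apply/permP=> i; apply/val_inj.
by rewrite -[LHS]nth_perm_code pq nth_perm_code.
Qed.

Lemma perm_code1 : perm_code 1%g = iota 0 12.
Proof.
rewrite -[RHS]map_id; apply/eq_in_map => k; rewrite mem_iota => lt_k.
by rewrite perm1 inordK.
Qed.

Lemma perm_codeM : {morph perm_code : p q / (p * q)%g >-> pmul p q}.
Proof.
move=> p q; rewrite /pmul -map_comp; apply/eq_map => k /=.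
by rewrite permM nth_perm_code.
Qed.

Lemma perm_codeV p : perm_code p^-1%g = pinv (perm_code p).
Proof.
apply/eq_in_map => k; rewrite mem_iota add0n => lt_k.
set j := p^-1%g (inord k).
have def_k : p j = k :> nat by rewrite permKV inordK.
rewrite -[k in RHS]def_k -(nth_perm_code p j) index_uniq ?size_mkseq //.
apply/(mkseq_uniqP _ _) => a b lt_a lt_b /val_inj/perm_inj/(congr1 val).
by rewrite /= !inordK.
Qed.

Definition list_fun (l : seq nat) (i : 'I_12) : 'I_12 := inord (nth 0%N l i).

(** The generators are involutions, and being its own inverse is a computable condition that makes
    the list a permutation. *)
Definition involution_code (l : seq nat) : bool :=
  (size l == 12) &&
  all (fun i => (nth 0 l i < 12) && (nth 0 l (nth 0 l i) == i))%N (iota 0 12).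

Lemma list_fun_inj l : involution_code l -> injective (list_fun l).
Proof.
case/andP=> _ /allP inv_l; suff: involutive (list_fun l) by apply: inv_inj.
move=> i; have /inv_l/andP[lt_l /eqP l_l] : (i : nat) \in iota 0 12.
  by rewrite mem_iota ltn_ord.
by rewrite /list_fun (inordK lt_l) l_l inord_val.
Qed.

Lemma perm_code_list l (inv_l : involution_code l) :
  perm_code (perm (list_fun_inj inv_l)) = l.
Proof.
have /andP[/eqP sz_l /allP inv] := inv_l.
apply: (@eq_from_nth _ 0%N) => [|i]; first by rewrite size_mkseq.
rewrite size_mkseq => lt_i; rewrite nth_mkseq // permE /list_fun.
have /inv/andP[lt_l _] : i \in iota 0 12 by rewrite mem_iota.
by rewrite !inordK.
Qed.

Lemma H3_perm_model :
  exists x y z : {perm 'I_12},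
    [/\ H3_relations x y z, perm_code x = point_perm 0,
        perm_code y = point_perm 1 & perm_code z = point_perm 2].
Proof.
have inv0 : involution_code (point_perm 0) by vm_compute.
have inv1 : involution_code (point_perm 1) by vm_compute.
have inv2 : involution_code (point_perm 2) by vm_compute.
exists (perm (list_fun_inj inv0)), (perm (list_fun_inj inv1)), (perm
  (list_fun_inj inv2)).
split; rewrite ?perm_code_list //.
by split; split; apply: perm_code_inj;
  rewrite !expgS ?expg0 ?(perm_codeM, perm_code1, perm_code_list); vm_compute.
Qed.

End PermCode.

(** * Enumeration of the abstract group and its faithful permutation model *)

Section H3.

Variables (gT : finGroupType) (s t u : gT).
Hypothesis H3 : H3_coxeter_system s t u.

Definition gen (a : nat) : gT := nth 1%g [:: s; t; u] a.

Let evg := ev gen.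

Lemma gen_involution a : (gen a ^+ 2 = 1)%g.
Proof.
have [_ [[s2 t2 u2] _] _] := H3; case: a => [|[|[|a]]] //=.
by rewrite /gen nth_default ?expg1n.
Qed.

(** Splits a relator into the two sides of a rewriting rule, reversal being inversion on words in
    involutions. *)
Lemma ev_rev_eq v w : (evg (v ++ w) = 1 -> evg v = evg (rev w))%g.
Proof.
rewrite /evg ev_cat ev_rev => [/eqP|a _]; last exact: gen_involution.
by rewrite -eq_invg_mul => /eqP <-; rewrite invgK.
Qed.

Lemma coxeter_rules_sound : sound gen coxeter_rules.
Proof.
have [_ [_ [st5 tu3 su2]] _] := H3.
move=> r; rewrite !inE.
case/or4P => [/eqP->|/eqP->|/eqP->|/or3P[]/eqP->].
- by rewrite /= mulg1 -expg2 gen_involution.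
- by rewrite /= mulg1 -expg2 gen_involution.
- by rewrite /= mulg1 -expg2 gen_involution.
- by apply/esym; apply: (@ev_rev_eq [:: 0; 2]%N [:: 0; 2]%N);
    rewrite /evg /= mulg1 mulgA -expg2.
- apply/esym; apply: (@ev_rev_eq [:: 1; 2; 1]%N [:: 2; 1; 2]%N).
  by rewrite /evg /= mulg1 -tu3 !expgS expg0 mulg1 !mulgA.
- apply/esym; apply: (@ev_rev_eq [:: 0; 1; 0; 1; 0]%N [:: 1; 0; 1; 0; 1]%N).
  by rewrite /evg /= mulg1 -st5 !expgS expg0 mulg1 !mulgA.
Qed.

(** Each added rule resolves one overlap. The short list of rules reduces the overlap in one way,
    giving the left side; the full list reduces it in the other, giving the right side. *)
Lemma H3_rules_sound : sound gen H3_rules.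
Proof.
have S0 := coxeter_rules_sound.
have S1 := @sound_overlap _ gen _ [:: ([:: 2; 0], [:: 0; 2])]%N 3
  [:: 2; 1; 2; 0]%N _ _ S0 isT erefl erefl.
have S2 := @sound_overlap _ gen _ [:: ([:: 2; 1; 2], [:: 1; 2; 1])]%N 3
  [:: 2; 1; 0; 2; 1; 2]%N _ _ S1 isT erefl erefl.
have S3 := @sound_overlap _ gen _
  [:: ([:: 2; 0], [:: 0; 2]); ([:: 1; 0; 1; 0; 1], [:: 0; 1; 0; 1; 0])]%N 5
  [:: 2; 1; 0; 1; 2; 1; 0; 1; 0; 1]%N _ _ S2 isT erefl erefl.
exact: S3.
Qed.

(** The normal words, of length at most 15, contain the empty word and are closed under appending a
    letter and reducing, so their values exhaust the generated group. *)
Lemma normal_words_ev g : exists2 w, w \in normal_words & g = evg w.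
Proof.
have [gen_gT _ _] := H3; have: g \in <<[set s; t; u]>>%g by rewrite gen_gT inE.
case/gen_prodgP=> n [c stu_c ->]; elim: n c stu_c => [|n IHn] c stu_c.
  by exists [::]; rewrite ?big_ord0 // normal_words.unlock; vm_compute.
rewrite big_ord_recr /=; have [|w Nw ->] := IHn (fun i => c (widen_ord (leqnSn
  n) i)).
  by move=> i; apply: stu_c.
have [a a_lt3 ->]: exists2 a, a \in iota 0 3 & c ord_max = gen a.
  have := stu_c ord_max; rewrite !inE -orbA.
  by case/or3P=> /eqP->; [exists 0%N | exists 1%N | exists 2%N].
exists (reduce 30 H3_rules (rcons w a)).
  pose closed_under ws := all (fun v => all (fun b =>
      reduce 30 H3_rules (rcons v b) \in ws) (iota 0 3)) ws.
  have closed: closed_under normal_words.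
    by rewrite normal_words.unlock; vm_compute.
  exact: allP (allP closed w Nw) a a_lt3.
by rewrite /evg ev_reduce ?ev_rcons //; apply: H3_rules_sound.
Qed.

Definition code_spec (code : gT -> seq nat) : Prop :=
  [/\ injective code, {morph code : x y / (x * y)%g >-> pmul x y},
      forall x, code x^-1%g = pinv (code x) &
      forall w, all (mem (iota 0 3)) w -> code (evg w) = pword w].

(** The universal property provides a homomorphism to permutations. It is injective because every
    element is the value of a normal word and distinct normal words give distinct permutations. *)
Lemma H3_code : exists code, code_spec code.
Proof.
have [_ _ univ] := H3.
have [x [y [z [rel_xyz code_x code_y code_z]]]] := H3_perm_model.
have [f [fM [fs ft fu]]] := univ _ x y z rel_xyz.
have f1 : f 1%g = 1%g by apply: (mulgI (f 1%g)); rewrite -fM !mulg1.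
pose code g := perm_code (f g).
have codeM : {morph code : a b / (a * b)%g >-> pmul a b}.
  by move=> a b; rewrite /code fM perm_codeM.
have code_ev w : all (mem (iota 0 3)) w -> code (evg w) = pword w.
  elim: w => [|a w IHw] /=; first by rewrite /code f1 perm_code1.
  case/andP=> a_lt3 /IHw code_w; rewrite codeM code_w; congr pmul.
  move: a_lt3; rewrite /code /gen !inE.
  by case/or3P => /eqP-> /=; rewrite ?fs ?ft ?fu.
have lt3 w : w \in normal_words -> all (mem (iota 0 3)) w.
  by apply/allP; rewrite normal_words.unlock; vm_compute.
exists code; split=> // [g h|g].
  have [v Nv ->] := normal_words_ev g; have [w Nw ->] := normal_words_ev h.
  rewrite !code_ev ?lt3 // => eq_vw; congr evg.
  have uniq_perms : uniq H3_perms by rewrite /H3_perms normal_words.unlock;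
    vm_compute.
  exact: (uniq_map_inj uniq_perms).
by rewrite /code -perm_codeV; congr perm_code; apply: (mulgI (f g));
  rewrite -fM !mulgV.
Qed.

(** * Transfer of sums over the group to sums over lists *)

Variable code : gT -> seq nat.
Hypothesis codeP : code_spec code.

Lemma normal_words_letters w : w \in normal_words -> all (mem (iota 0 3)) w.
Proof. by move: w; apply/allP; rewrite normal_words.unlock; vm_compute. Qed.

Lemma code_H3_perms g : code g \in H3_perms.
Proof.
have [_ _ _ code_ev] := codeP; have [w Nw ->] := normal_words_ev g.
by rewrite code_ev ?normal_words_letters // map_f.
Qed.

Lemma H3_perms_code p : p \in H3_perms -> exists g, code g = p.
Proof.
have [_ _ _ code_ev] := codeP; case/mapP=> w Nw ->; exists (evg w).
by rewrite code_ev ?normal_words_letters.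
Qed.

Definition encodes (l : seq (seq nat)) (A : {set gT}) : Prop :=
  [/\ uniq l, {subset l <= H3_perms} & forall g, (g \in A) = (code g \in l)].

Lemma perm_encodes l (A : {set gT}) :
  encodes l A -> perm_eq [seq code g | g <- enum A] l.
Proof.
have [inj_code _ _ _] := codeP; case=> uniq_l sub_l memA.
apply: uniq_perm => // [|p]; first by rewrite map_inj_uniq ?enum_uniq.
apply/mapP/idP=> [[g]|lp]; first by rewrite mem_enum memA => ? ->.
have [g def_p] := H3_perms_code (sub_l p lp).
by exists g; rewrite ?mem_enum ?memA def_p.
Qed.

Lemma big_encodes (R : nmodType) l (A : {set gT}) (F : seq nat -> R) :
  encodes l A -> \sum_(g in A) F (code g) = \sum_(p <- l) F p.
Proof. by move/perm_encodes/(perm_big _) <-; rewrite big_map big_enum. Qed.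

Lemma card_encodes l (A : {set gT}) : encodes l A -> #|A| = size l.
Proof. by move/perm_encodes/perm_size <-; rewrite size_map cardE. Qed.

Lemma encodes_setT : encodes H3_perms [set: gT].
Proof.
split=> [||g] //; first by rewrite /H3_perms normal_words.unlock; vm_compute.
by rewrite inE code_H3_perms.
Qed.

Lemma card_H3 : #|gT| = 120%N.
Proof. by rewrite -cardsT (card_encodes encodes_setT) /H3_perms
  normal_words.unlock; vm_compute. Qed.

(** Words in the two letters evaluate into the subgroup. Conversely, the list contains the identity
    and is closed under right multiplication by the two generators. *)
Lemma encodes_parabolic a b :
    all (mem (iota 0 3)) [:: a; b] ->
    all (fun p =>
        all (fun c => pmul p (point_perm c) \in parabolic_perms [:: a; b])
          [:: a; b])
      (parabolic_perms [:: a; b]) ->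
  encodes (parabolic_perms [:: a; b]) <<[set gen a; gen b]>>%G.
Proof.
have [inj_code codeM _ code_ev] := codeP.
have uniq_perms : uniq H3_perms by rewrite /H3_perms normal_words.unlock;
  vm_compute.
move=> ab3 /allP closed.
have sub_perms : {subset parabolic_perms [:: a; b] <= H3_perms}.
  by move=> p /mapP[w]; rewrite mem_filter => /andP[_ Nw] ->; apply: map_f.
split=> // [|g].
  apply: subseq_uniq uniq_perms; apply: map_subseq; apply: filter_subseq.
apply/idP/idP=> [|/mapP[w]]; last first.
  rewrite mem_filter => /andP[abw Nw].
  rewrite -code_ev ?normal_words_letters //.
  move/inj_code->; elim: w abw {Nw} => /= [_|c w IHw]; first exact: group1.
  case/andP=> ab_c /IHw; apply: groupM; apply: mem_gen.
  by move: ab_c; rewrite !inE => /orP[]/eqP->; rewrite eqxx ?orbT.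
have code1 : code 1%g \in parabolic_perms [:: a; b].
  by rewrite -[1%g]/(evg [::]) code_ev // map_f // mem_filter
    normal_words.unlock; vm_compute.
case/gen_prodgP=> n [c ab_c ->]; elim: n c ab_c => [|n IHn] c ab_c.
  by rewrite big_ord0.
rewrite big_ord_recr /= codeM.
have /IHn/closed/allP : forall i,
    c (widen_ord (leqnSn n) i) \in [set gen a; gen b].
  by move=> i; apply: ab_c.
have codeg d : d \in iota 0 3 -> code (gen d) = point_perm d.
  move=> d3; have := code_ev [:: d]; rewrite /= mulg1 d3 => -> //.
  by move: d3; rewrite !inE => /or3P[]/eqP->; vm_compute.
have /and3P[/= a3 b3 _] := ab3.
by move=> cl; have := ab_c ord_max; rewrite !inE => /orP[]/eqP->;
  rewrite codeg // cl // !inE eqxx ?orbT.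
Qed.

Definition encodes_cfun (H : {group gT}) (phi : 'CF(H)) l neg : Prop :=
  encodes l H /\ forall g, phi g = (pm_sign neg l (code g))%:~R.

(** Clearing the denominator [#|H| * #|K|] leaves an identity between integers, to be decided by
    computation. *)
Lemma cfdot_Ind_encodes (H K : {group gT}) (phi : 'CF(H)) (psi : 'CF(K))
    l neg m neg' n :
    encodes_cfun phi l neg -> encodes_cfun psi m neg' ->
    intertwining_count H3_perms l neg m neg' = (size l * size m * n)%:Z ->
  '['Ind[[set: gT]] phi, 'Ind[[set: gT]] psi] = n%:R.
Proof.
have [_ codeM codeV _] := codeP.
move=> [enc_l phiE] [enc_m psiE] count.
rewrite cfdot_Ind ?subsetT // (card_encodes enc_l) (card_encodes enc_m).
pose F := pm_sign neg l; pose F' := pm_sign neg' m.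
pose sumG p : int := \sum_(q <- H3_perms) F p * F' (pconj p q).
rewrite (eq_bigr (fun h => (sumG (code h))%:~R)) => [|h Hh]; last first.
  rewrite /sumG -(big_encodes (fun q => F _ * F' (pconj _ q)) encodes_setT)
    rmorph_sum /=.
  apply: eq_bigr => x _; rewrite phiE psiE rmorphM /= rmorph_int;
    congr (_ * _%:~R).
  by rewrite conjgE !codeM codeV.
rewrite (big_encodes (fun p => (sumG p)%:~R) enc_l) -rmorph_sum.
have ->: \sum_(p <- l) sumG p = (size l * size m * n)%:Z.
  by rewrite -count /intertwining_count foldrE big_map; apply: eq_bigr => p _;
    rewrite foldrE big_map.
rewrite /= -pmulrn !natrM mulKf // mulf_neq0 //.
  by rewrite -(card_encodes enc_l) neq0CG.
by rewrite -(card_encodes enc_m) neq0CG.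
Qed.

Lemma encodes_inversion_invariant (H : {group gT}) (phi : 'CF(H)) l neg :
    encodes_cfun phi l neg -> inversion_check H3_perms l neg ->
  inversion_invariant [set: gT] phi.
Proof.
have [inj_code codeM codeV _] := codeP.
case=> [[_ sub_l memH] phiE] /andP[/allP FV /allP trick]; split=> [h|x _].
  by rewrite memH => lh; rewrite !phiE codeV (eqP (FV _ lh)).
have /hasP[h lh /hasP[k lk]] := trick _ (code_H3_perms x).
have [h' def_h] := H3_perms_code (sub_l h lh).
have [k' def_k] := H3_perms_code (sub_l k lk).
rewrite -def_h -def_k /= -!codeM -codeV !(inj_eq inj_code) => alt.
exists h', k'; split; rewrite ?memH ?def_h ?def_k // !phiE -intrM.
case/orP: alt => /andP[/eqP-> c1]; [left | right]; split=> //.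
  by rewrite (eqP c1).
by rewrite (eqr_int _ _ 1).
Qed.

Lemma encodes_cfun1 (H : {group gT}) l :
  encodes l H -> encodes_cfun (1 : 'CF(H)) l [::].
Proof.
by move=> enc; split=> // g; have [_ _ memH] := enc;
  rewrite cfun1E memH /pm_sign; case: (_ \in l).
Qed.

(** * The parabolic subgroups and the character [alpha] *)

Lemma encodes_Hst : encodes (parabolic_perms [:: 0; 1]%N) <<[set s; t]>>%G.
Proof.
by apply: (@encodes_parabolic 0 1); rewrite // /parabolic_perms
  normal_words.unlock; vm_compute.
Qed.

Lemma encodes_Htu : encodes (parabolic_perms [:: 1; 2]%N) <<[set t; u]>>%G.
Proof.
by apply: (@encodes_parabolic 1 2); rewrite // /parabolic_perms
  normal_words.unlock; vm_compute.
Qed.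

Lemma encodes_Hsu : encodes (parabolic_perms [:: 0; 2]%N) <<[set s; u]>>%G.
Proof.
by apply: (@encodes_parabolic 0 2); rewrite // /parabolic_perms
  normal_words.unlock; vm_compute.
Qed.

Lemma cfnorm_Ind_Hst : '['Ind[[set: gT]] (1 : 'CF(<<[set s; t]>>%G))] = 4.
Proof.
apply: (cfdot_Ind_encodes (n := 4) (encodes_cfun1 encodes_Hst) (encodes_cfun1
  encodes_Hst)).
by rewrite /H3_perms /parabolic_perms normal_words.unlock; vm_compute.
Qed.

Lemma cfnorm_Ind_Htu : '['Ind[[set: gT]] (1 : 'CF(<<[set t; u]>>%G))] = 6.
Proof.
apply: (cfdot_Ind_encodes (n := 6) (encodes_cfun1 encodes_Htu) (encodes_cfun1
  encodes_Htu)).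
by rewrite /H3_perms /parabolic_perms normal_words.unlock; vm_compute.
Qed.

Lemma cfdot_Ind_Hsu_Hst :
  '['Ind[[set: gT]] (1 : 'CF(<<[set s; u]>>%G)),
    'Ind[[set: gT]] (1 : 'CF(<<[set s; t]>>%G))] = 5.
Proof.
apply: (cfdot_Ind_encodes (n := 5) (encodes_cfun1 encodes_Hsu) (encodes_cfun1
  encodes_Hst)).
by rewrite /H3_perms /parabolic_perms normal_words.unlock; vm_compute.
Qed.

Lemma gelfand_pair_Hst : gelfand_pair [set: gT]%G <<[set s; t]>>%G.
Proof.
apply: gelfand_trick; rewrite ?subsetT ?cfun1_lin_char //.
apply: (encodes_inversion_invariant (encodes_cfun1 encodes_Hst)).
by rewrite /H3_perms /parabolic_perms normal_words.unlock; vm_compute.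
Qed.

Lemma gelfand_pair_Htu : gelfand_pair [set: gT]%G <<[set t; u]>>%G.
Proof.
apply: gelfand_trick; rewrite ?subsetT ?cfun1_lin_char //.
apply: (encodes_inversion_invariant (encodes_cfun1 encodes_Htu)).
by rewrite /H3_perms /parabolic_perms normal_words.unlock; vm_compute.
Qed.

Lemma parabolic_su_words :
  [seq w <- normal_words | all (mem [:: 0; 2]%N) w] =
  [:: [::]; [:: 0]; [:: 2]; [:: 0; 2]]%N.
Proof. by rewrite normal_words.unlock; vm_compute. Qed.

(** The subgroup consists of [1], [s], [u] and [s * u], so the values on [s] and [u] determine
    [alpha]. *)
Lemma encodes_alpha (alpha : 'CF(<<[set s; u]>>%G)) :
    alpha \is a linear_char -> alpha s = 1 -> alpha u = -1 ->
  encodes_cfun alpha (parabolic_perms [:: 0; 2]%N) su_neg.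
Proof.
have [inj_code _ _ code_ev] := codeP; have enc := encodes_Hsu;
  have [_ _ memH] := enc.
move=> Lalpha alpha_s alpha_u; split=> // g.
have [Hg|notHg] := boolP (g \in <<[set s; u]>>%G); last first.
  by rewrite cfun0 // /pm_sign -memH (negPf notHg).
have Hs : s \in <<[set s; u]>>%G by rewrite mem_gen ?set21.
have Hu : u \in <<[set s; u]>>%G by rewrite mem_gen ?set22.
have := Hg; rewrite memH /parabolic_perms parabolic_su_words => /mapP[w su_w].
have w3 : all (mem (iota 0 3)) w.
  by move: w su_w; apply/allP; vm_compute.
rewrite -code_ev // => /inj_code ->; rewrite code_ev //.
move: su_w; rewrite !inE => /or4P[]/eqP-> /=; rewrite ?mulg1.
- by rewrite (_ : pm_sign _ _ _ = 1) // lin_char1.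
- by rewrite (_ : pm_sign _ _ _ = 1) // alpha_s.
- by rewrite (_ : pm_sign _ _ _ = -1) // alpha_u.
- by rewrite (_ : pm_sign _ _ _ = -1) // lin_charM // alpha_s alpha_u mul1r.
Qed.

Lemma alpha_exists :
  exists alpha : 'CF(<<[set s; u]>>%G),
    [/\ alpha \is a linear_char, alpha s = 1 & alpha u = -1].
Proof.
have [_ codeM _ code_ev] := codeP; have [_ _ memH] := encodes_Hsu.
set l := parabolic_perms [:: 0; 2]%N in memH.
have def_l : l = [seq pword w | w <- [:: [::]; [:: 0]; [:: 2]; [:: 0; 2]]]%N.
  by rewrite /l /parabolic_perms parabolic_su_words.
have F1 w c : all (mem (iota 0 3)) w -> pm_sign su_neg l (pword w) = c ->
    (pm_sign su_neg l (code (evg w)))%:~R = c%:~R :> algC.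
  by move=> w3 <-; rewrite code_ev.
have [||alpha Lalpha alphaE] := @lin_char_of_morph _ <<[set s; u]>>%G
    (fun g => (pm_sign su_neg l (code g))%:~R).
- by rewrite -[1%g]/(evg [::]) (F1 _ 1) // def_l.
- move=> g h /=; rewrite !memH codeM => lg lh; rewrite -intrM; congr _%:~R.
  (* Multiplicativity of the sign table is checked on all 16 pairs. *)
  have morph_l : all (fun p => all (fun q => pm_sign su_neg l (pmul p q) ==
      pm_sign su_neg l p * pm_sign su_neg l q) l) l by rewrite def_l;
        vm_compute.
  by have /allP/(_ _ lg)/allP/(_ _ lh)/eqP := morph_l.
exists alpha; split=> //.
  rewrite alphaE ?mem_gen ?set21 // -[s]mulg1 -[(_ * _)%g]/(evg [:: 0%N]).
  by rewrite (F1 _ 1) // def_l.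
rewrite alphaE ?mem_gen ?set22 // -[u]mulg1 -[(_ * _)%g]/(evg [:: 2%N]).
by rewrite (F1 _ (-1)) // def_l.
Qed.

Lemma cfnorm_Ind_alpha (alpha : 'CF(<<[set s; u]>>%G)) :
    alpha \is a linear_char -> alpha s = 1 -> alpha u = -1 ->
  '['Ind[[set: gT]] alpha] = 8.
Proof.
move=> Lalpha alpha_s alpha_u; have enc := encodes_alpha Lalpha alpha_s alpha_u.
apply: (cfdot_Ind_encodes (n := 8) enc enc).
by rewrite /H3_perms /parabolic_perms normal_words.unlock; vm_compute.
Qed.

Lemma gelfand_triple_alpha (alpha : 'CF(<<[set s; u]>>%G)) :
    alpha \is a linear_char -> alpha s = 1 -> alpha u = -1 ->
  linear_gelfand_triple [set: gT]%G alpha.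
Proof.
move=> Lalpha alpha_s alpha_u; apply: gelfand_trick => //; rewrite ?subsetT //.
apply: (encodes_inversion_invariant (encodes_alpha Lalpha alpha_s alpha_u)).
by rewrite /H3_perms /parabolic_perms normal_words.unlock; vm_compute.
Qed.

Lemma not_gelfand_pair_Hsu : ~ gelfand_pair [set: gT]%G <<[set s; u]>>%G.
Proof.
case=> _ _ mf; have Ind_char (H : {group gT}) :
  'Ind[[set: gT]] (1 : 'CF(H)) \is a character by rewrite cfInd_char ?rpred1.
(* The inequality would read [5 <= 4]. *)
have := cfdot_multiplicity_free (Ind_char _) (Ind_char <<[set s; t]>>%G) mf.
by rewrite cfdot_Ind_Hsu_Hst cfnorm_Ind_Hst ler_nat.
Qed.

(** A normal word is shorter than the group order, so the search in [iota] succeeds and does not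
    return its default. *)
Lemma coxeter_lengthP w : w \in ([set s; t; u] ^+ coxeter_length [set s; t;
  u] w)%g.
Proof.
have [v Nv def_w] := normal_words_ev w.
have: has (fun n => w \in ([set s; t; u] ^+ n)%g) (iota 0 #|gT|).
  apply/hasP; exists (size v).
    rewrite mem_iota card_H3 add0n /=; move: v Nv {def_w}.
    by apply/allP; rewrite normal_words.unlock; vm_compute.
  have := normal_words_letters Nv; rewrite def_w /evg.
  elim: (v) => [|a v' IHv] /=; first by rewrite expg0 inE.
  case/andP=> a3 /IHv v'_in; rewrite expgS; apply: mem_mulg => //.
  by move: a3; rewrite !inE => /or3P[]/eqP->; rewrite eqxx ?orbT.
move=> has_w; have := nth_find 0%N has_w; rewrite nth_iota //.
by move: has_w; rewrite has_find size_iota.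
Qed.

End H3.

(** * The sign character and its kernel *)

(** The universal property sends all three generators to the transposition of [bool]; the sign is
    its parity. *)
Lemma sign_hom (gT : finGroupType) (s t u : gT) :
    H3_coxeter_system s t u ->
  exists omega : 'CF([set: gT]),
    [/\ omega \is a linear_char, omega s = -1, omega t = -1 & omega u = -1].
Proof.
case=> _ _ /(_ {perm bool}) univ; pose x := tperm true false.
have xx : (x * x = 1)%g by rewrite tperm2.
have [|f [fM fstu]] := univ x x x; first by split; split;
  rewrite ?xx ?expg1n ?expg2 ?xx.
pose chi g : algC := (-1) ^+ (f g : bool).
have [||omega Lomega omegaE] := @lin_char_of_morph _ [set: gT]%G chi.
- by rewrite /chi (_ : f 1%g = 1%g) ?odd_perm1 //; apply: (mulgI (f 1%g));
    rewrite -fM !mulg1.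
- by move=> g h _ _; rewrite /chi fM odd_permM signr_addb.
by case: fstu => fs ft fu; exists omega; split; rewrite ?omegaE ?inE // /chi
   ?fs ?ft ?fu odd_tperm.
Qed.

(** Translation by [x] carries the kernel onto its complement, so the index is 2. The kernel being
    normal, the index is also the norm of the induced trivial character. *)
Lemma rank_two_kernel (gT : finGroupType) (G : {group gT}) (omega : 'CF(G)) x :
    omega \is a linear_char -> {in G, forall y, omega y = 1 \/ omega y = -1} ->
    x \in G -> omega x = -1 ->
  gelfand_pair G (cfker_group omega) /\
  gelfand_rank G (1 : 'CF(cfker_group omega)) = 2%N.
Proof.
move=> Lomega sgn Gx omega_x; pose K := cfker_group omega.
have nsKG : K <| G by apply: cfker_normal.
have memK y : y \in G -> (y \in K) = (omega y == 1).
  by move=> Gy; rewrite /= cfkerEchar ?lin_charW // inE Gy lin_char1.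
have index2 : #|G : K| = 2%N.
  have card_compl : #|G :\: K| = #|K|.
    rewrite -(card_lcoset K x); apply: eq_card => y; rewrite mem_lcoset inE.
    have [Gy|notGy] := boolP (y \in G); last first.
      rewrite andbF; apply/esym/negP=> /(subsetP (normal_sub nsKG)).
      by rewrite groupMl ?groupV // (negPf notGy).
    rewrite andbT !memK ?groupM ?groupV // lin_charM ?groupV // lin_charV //.
    rewrite omega_x invrN invr1 mulN1r.
    by case: (sgn y Gy) => ->; rewrite ?opprK eqxx ?eqNr ?oner_eq0 //
      eq_sym -subr_eq0 opprK ?(eqr_nat _ 2 0).
  apply/eqP; rewrite -divgS ?normal_sub // -(cardsID K G) card_compl.
  by rewrite (setIidPr (normal_sub nsKG)) addnn -mul2n mulnK ?cardG_gt0.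
have norm2 : '['Ind[G] (1 : 'CF(K))] = 2 by rewrite cfnorm_Ind_cfun1 // index2.
split.
  split; rewrite ?cfun1_lin_char ?normal_sub //.
  by apply: multiplicity_free_cfnorm; rewrite ?cfInd_char ?rpred1 // norm2
    ltr_nat.
apply/eqP; rewrite -(eqr_nat algC).
by rewrite gelfand_rank_cfnorm ?cfun1_lin_char ?normal_sub // norm2.
Qed.

(** Any expression of [w] as a product of [n] generators gives the sign; with [coxeter_lengthP] this
    identifies [omega] with the parity of the length. *)
Lemma lin_char_pow (gT : finGroupType) (omega : 'CF([set: gT])) (S : {set gT})
  n w :
    omega \is a linear_char -> {in S, forall x, omega x = -1} ->
  w \in (S ^+ n)%g -> omega w = (-1) ^+ n.
Proof.
move=> Lomega omega_S; elim: n w => [|n IHn] w.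
  by rewrite expg0 inE => /eqP->; rewrite lin_char1.
rewrite expgS => /mulsgP[x y Sx Sy ->].
by rewrite lin_charM ?inE // omega_S // IHn // exprS.
Qed.

Theorem corollary6p6 (gT : finGroupType) (s t u : gT)
    (H3 : H3_coxeter_system s t u) :
  let W := [set: gT]%G in
  let Hst := <<[set s; t]>>%G in
  let Htu := <<[set t; u]>>%G in
  let Hsu := <<[set s; u]>>%G in
  [/\ gelfand_pair W Hst /\ gelfand_rank W (1 : 'CF(Hst)) = 4%N,
      gelfand_pair W Htu /\ gelfand_rank W (1 : 'CF(Htu)) = 6%N,
      exists omega : 'CF(W),
        [/\ omega \is a linear_char,
            forall w : gT, omega w = (-1) ^+ coxeter_length [set s; t; u] w,
            gelfand_pair W (cfker_group omega)
          & gelfand_rank W (1 : 'CF(cfker_group omega)) = 2%N],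
      (exists alpha : 'CF(Hsu),
         [/\ alpha \is a linear_char, alpha s = 1 & alpha u = -1]) /\
      (forall alpha : 'CF(Hsu),
         alpha \is a linear_char -> alpha s = 1 -> alpha u = -1 ->
         linear_gelfand_triple W alpha /\ gelfand_rank W alpha = 8%N)
    & ~ gelfand_pair W Hsu].
Proof.
move=> W Hst Htu Hsu; have [code codeP] := H3_code H3.
have rankE (H : {group gT}) (lambda : 'CF(H)) n : lambda \is a linear_char ->
    '['Ind[W] lambda] = n%:R -> gelfand_rank W lambda = n.
  move=> Llambda norm_n; apply/eqP; rewrite -(eqr_nat algC).
  by rewrite gelfand_rank_cfnorm ?subsetT ?norm_n.
split.
- split; first exact: gelfand_pair_Hst codeP.
  by apply: rankE; rewrite ?cfun1_lin_char //; apply: cfnorm_Ind_Hst codeP.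
- split; first exact: gelfand_pair_Htu codeP.
  by apply: rankE; rewrite ?cfun1_lin_char //; apply: cfnorm_Ind_Htu codeP.
- have [omega [Lomega omega_s omega_t omega_u]] := sign_hom H3; exists omega.
  have omegaE w : omega w = (-1) ^+ coxeter_length [set s; t; u] w.
    apply: lin_char_pow Lomega _ (coxeter_lengthP H3 codeP w) => x.
    by rewrite !inE -orbA => /or3P[]/eqP->.
  have [|gelf rank2] := rank_two_kernel Lomega _ (in_setT s) omega_s => //.
  by move=> w _; rewrite omegaE -signr_odd; case: odd; [right | left].
- split; first exact: alpha_exists codeP.
  move=> alpha Lalpha alpha_s alpha_u.
  split; first exact: gelfand_triple_alpha codeP _ Lalpha alpha_s alpha_u.
  by apply: rankE => //; apply: cfnorm_Ind_alpha codeP _ Lalpha alpha_s alpha_u.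
- exact: not_gelfand_pair_Hsu codeP.
Qed.
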